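(* Let $u$ be a harmonic function either on a Cayley graph $\mathrm{Cay}(A,S)$ of a finitely generated Abelian group $A$ with finite generating set $S$, or on $\mathbb{R}^d$. Then $\Delta^k(u^2)$ is non-negative (pointwise) for all integers $k\ge0$.
   Context: On $\mathrm{Cay}(A,S)$, functions are functions $f:A\to\mathbb{R}$ and the Laplacian is $(\Delta f)(x)=\frac{1}{|S|}\sum_{s\in S}(f(x+s)-f(x))$; on $\mathbb{R}^d$, $\Delta$ is the usual Laplacian. In both cases $u$ (real-valued, defined everywhere) is harmonic if $\Delta u\equiv0$. $\Delta^k$ denotes the $k$-th iterate of $\Delta$, with $\Delta^0$ the identity. *)

(* Defs.v *)
From mathcomp Require Export all_boot all_order all_algebra.
From mathcomp Require Export finmap.
From mathcomp Require Export boolp classical_sets reals topology normedtype derive.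
Export GRing.Theory Num.Theory numFieldNormedType.Exports.

Set Implicit Arguments.
Unset Strict Implicit.
Unset Printing Implicit Defensive.

Local Open Scope ring_scope.

(* The only additive subgroup of A containing S is A itself; S need not be
   symmetric, and it may contain 0. *)
Definition generating (A : zmodType) (S : {fset A}) : Prop :=
  forall H : {pred A}, zmod_closed H -> {subset S <= H} -> forall a, a \in H.

Definition cay_laplacian (R : realType) (A : zmodType) (S : {fset A})
    (f : A -> R) : A -> R :=
  fun x => (#|` S|%:R)^-1 * \sum_(s <- S) (f (x + s) - f x).

Definition cay_harmonic (R : realType) (A : zmodType) (S : {fset A})
    (u : A -> R) : Prop :=
  forall x, cay_laplacian S u x = 0.

Definition partial (R : realType) (d : nat) (i : 'I_d) (f : 'rV[R]_d -> R) :
    'rV[R]_d -> R :=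
  'D_'e_i f.

Definition laplacian (R : realType) (d : nat) (f : 'rV[R]_d -> R) :
    'rV[R]_d -> R :=
  fun x => \sum_(i < d) partial i (partial i f) x.

Definition C1 (R : realType) (d : nat) (f : 'rV[R]_d -> R) : Prop :=
  forall i : 'I_d,
    (forall x, derivable f x 'e_i) /\ continuous (partial i f).

Definition C2 (R : realType) (d : nat) (f : 'rV[R]_d -> R) : Prop :=
  C1 f /\ forall i : 'I_d, C1 (partial i f).

(* 'D is total, with a junk value where the derivative does not exist, so the
   C^2 regularity implicit in "harmonic" has to be required explicitly. It is
   enough to make the iterated Laplacians of u^2 genuine, as C^2 harmonic
   functions are smooth. *)
Definition harmonic (R : realType) (d : nat) (u : 'rV[R]_d -> R) : Prop :=
  C2 u /\ forall x, laplacian u x = 0.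

(* Main.v *)
Require Import Defs.
From mathcomp Require Import functions ring lra.
Import Order.TTheory.

Set Implicit Arguments.
Unset Strict Implicit.
Unset Printing Implicit Defensive.

Local Open Scope ring_scope.
Local Open Scope classical_set_scope.

(* Applied to a finite sum of squares of harmonic functions, the Laplacian gives,
   up to a non-negative factor, the sum of the squares of their derivatives: the
   cross terms cancel by harmonicity. These derivatives (differences along
   the elements of S, resp. partial derivatives) are again harmonic, so one
   can iterate.

   On R^d the only real work is that a C^2 harmonic u is C^3, and this needs no
   integration. For the reflection r in the hyperplane x_k = 0, the harmonic
   function u - u o r vanishes on that hyperplane, and comparing it with an explicit
   superharmonic barrier on half of the unit cube bounds the k-th partial
   derivative of u at the centre by (d + 1) sup |u|. Applying this twice, to difference
   quotients and then to u, bounds the second derivatives of u by sup |u|.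
   Differences of two difference quotients of u are harmonic and uniformly small,
   hence the difference quotients of the second derivatives of u are locally
   uniformly Cauchy. *)

(** * Directional derivatives *)

Section Lines.
Context {R : realType} {V : normedModType R}.
Implicit Types (f : V -> R) (x v : V).

Lemma is_derive_line f x v (t : R) : derivable f (x + t *: v) v ->
  is_derive t 1 (fun s : R => f (x + s *: v)) ('D_v f (x + t *: v)).
Proof.
have E : (fun h : R => h^-1 *: (((fun s : R => f (x + s *: v)) \o shift t)
   (h *: 1) - f (x + t *: v))) =
  (fun h => h^-1 *: ((f \o shift (x + t *: v)) (h *: v) - f (x + t *: v))).
  by apply/funext => h /=; rewrite [h *: 1]mulr1 scalerDl addrCA.
by move=> df; split; rewrite /derivable /derive /= E.
Qed.

Lemma MVT_line f x v (t : R) : (forall s, derivable f (x + s *: v) v) ->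
  exists2 s, `|s| <= `|t| & f (x + t *: v) - f x = t * 'D_v f (x + s *: v).
Proof.
move=> df.
have dg (s : R) : is_derive s 1 (fun s : R => f (x + s *: v)) ('D_v f (x + s *: v)).
  exact: is_derive_line.
have cg A : {within A, continuous (fun s : R => f (x + s *: v))}.
  apply: continuous_subspaceT => s.
  by apply/differentiable_continuous/derivable1_diffP; have [] := dg s.
have [t0|t0] := leP 0 t.
  have [s] := MVT_segment t0 (fun s _ => dg s) (cg _).
  rewrite in_itv/= => /andP[s0 st]; rewrite scale0r addr0 subr0 => ->.
  by exists s; [rewrite !ger0_norm|rewrite mulrC].
have [s] := MVT_segment (ltW t0) (fun s _ => dg s) (cg _).
rewrite in_itv/= => /andP[ts s0]; rewrite scale0r addr0 sub0r => e.
exists s; first by rewrite !ler0_norm ?lerN2// ltW.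
by rewrite -opprB e mulrN opprK mulrC.
Qed.

Lemma derivable_diff_quotient f x v (e : R) : derivable f x v -> 0 < e ->
  exists2 d, 0 < d & forall h : R, h != 0 -> `|h| < d ->
    `|h^-1 * (f (x + h *: v) - f x) - 'D_v f x| < e.
Proof.
move=> df e0; have /cvgrPdist_lt /(_ _ e0) := df.
move=> [d /= d0 H]; exists d => // h h0 hd.
have := H h; rewrite /= sub0r normrN => /(_ hd h0).
by rewrite distrC [h *: v + x]addrC.
Qed.

Lemma is_derive_diff_quotient f x v (l : R) :
  (forall e, 0 < e -> exists2 d, 0 < d & forall h : R, h != 0 -> `|h| < d ->
    `|h^-1 * (f (x + h *: v) - f x) - l| < e) -> is_derive x v f l.
Proof.
move=> H.
have df : (fun h => h^-1 *: ((f \o shift x) (h *: v) - f x)) @ 0^' --> l.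
  apply/cvgrPdist_lt => e /H[d d0 {}H]; exists d => //= h.
  by rewrite /= sub0r normrN distrC [h *: v + x]addrC => hd h0; exact: H.
by split; [apply/cvg_ex; exists l|exact: cvg_lim].
Qed.

(** Only the derivative along [v] is assumed, so there is no differential to be linear in the
    direction. Instead, the quotient along [c *: v] with step [h] is [c] times the quotient along
    [v] with step [h * c]. *)
Lemma is_derive_scale f x v (c : R) : derivable f x v ->
  is_derive x (c *: v) f (c * 'D_v f x).
Proof.
have [->|c0] := eqVneq c 0.
  by move=> _; rewrite scale0r mul0r; exact: is_derive0.
move=> df; apply: is_derive_diff_quotient => e e0.
have ec0 : 0 < e / `|c| by rewrite divr_gt0// normr_gt0.
have [d d0 H] := derivable_diff_quotient df ec0.
exists (d / `|c|) => [|h h0 hd]; first by rewrite divr_gt0// normr_gt0.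
have := H (h * c); rewrite mulf_neq0// normrM -ltr_pdivlMr ?normr_gt0//.
move=> /(_ isT hd); rewrite ltr_pdivlMr ?normr_gt0// -normrM scalerA.
set X := f _ - _; set D := 'D_v f x.
by have -> : ((h * c)^-1 * X - D) * c = h^-1 * X - c * D by field; rewrite h0.
Qed.

Lemma is_derive_affine f (T : V -> V) x v w (l : R) :
  (forall h : R, T (x + h *: v) = T x + h *: w) ->
  is_derive (T x) w f l -> is_derive x v (f \o T) l.
Proof.
move=> TE.
have E : (fun h : R => h^-1 *: (((f \o T) \o shift x) (h *: v) - (f \o T) x)) =
  (fun h => h^-1 *: ((f \o shift (T x)) (h *: w) - f (T x))).
  by apply/funext => h /=; rewrite [h *: v + x]addrC TE [_ + T x]addrC.
by case=> df dE; split; rewrite /derivable /derive E.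
Qed.

(** Positive steps suffice, which matters because the barrier controls a function on one side of the
    hyperplane only. *)
Lemma derive_le f x v (M d : R) : derivable f x v -> 0 < d ->
  (forall h : R, 0 < h < d -> f (x + h *: v) - f x <= h * M) -> 'D_v f x <= M.
Proof.
move=> df d0 H; apply/ler_addgt0Pr => e e0.
have [d' d'0 H'] := derivable_diff_quotient df e0.
pose h := Num.min d d' / 2.
have m0 : 0 < Num.min d d' by rewrite lt_min d0.
have h0 : 0 < h by rewrite divr_gt0.
have hm : h < Num.min d d' by rewrite /h; lra.
move: hm; rewrite lt_min => /andP[hd hd'].
have := H' h; rewrite gt_eqF// (ger0_norm (ltW h0)) => /(_ isT hd').
rewrite ltr_norml => /andP[H1 _].
have := H h; rewrite h0 hd => /(_ isT) H2.
have : h^-1 * (f (x + h *: v) - f x) <= M by rewrite ler_pdivrMl.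
move=> H3; rewrite -lerBlDr (le_trans _ H3)//; apply: ltW; lra.
Qed.

(** Second-derivative test at a point where [f] is touched from above by a parabola. As the second
    derivative is only known to exist at [x], Taylor's formula is replaced by the mean value theorem
    for a symmetrised function [g]: a second derivative above [2 * q] would make [g'] positive at
    small positive arguments, while [g m <= g 0]. *)
Lemma derive2_le f x v (b q d : R) :
  (forall s : R, derivable f (x + s *: v) v) ->
  derivable ('D_v f) x v -> 0 < d ->
  (forall t, `|t| < d -> f (x + t *: v) - f x <= b * t + q * t ^+ 2) ->
  'D_v ('D_v f) x <= 2 * q.
Proof.
move=> df ddf d0 H; rewrite leNgt; apply/negP => lt2q.
(* With this tolerance the difference quotients of the first derivative at [x] exceed [2 * q]. *)
pose e := ('D_v ('D_v f) x - 2 * q).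
have e0 : 0 < e by rewrite subr_gt0.
have [d' d'0 H'] := derivable_diff_quotient ddf e0.
pose m := Num.min d d' / 2.
have m1 : 0 < Num.min d d' by rewrite lt_min d0.
have m0 : 0 < m by rewrite divr_gt0.
have mm : m < Num.min d d' by rewrite /m; lra.
move: mm; rewrite lt_min => /andP[md md'].
pose D := fun s : R => 'D_v f (x + s *: v).
(* Symmetrising in [s] removes the linear term [b]. *)
pose g (s : R) := f (x + s *: v) + f (x + (- s) *: v) - 2 * q * s ^+ 2.
pose g' (s : R) := D s - D (- s) - 4 * q * s.
have dg (s : R) : is_derive s 1 g (g' s).
  have h1 := is_derive_line (df s).
  have h2 : is_derive s 1 (fun s : R => f (x + (- s) *: v)) (- D (- s)).
    have -> : (fun s : R => f (x + (- s) *: v)) =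
        (fun s => f (x + s *: ((- 1) *: v))).
      by apply/funext => r; rewrite scalerA mulrN1.
    have := is_derive_scale (-1) (df (- s)).
    rewrite mulN1r -/(D (- s)) => -[h3 h4].
    have := @is_derive_line f x ((-1) *: v) s.
    by rewrite scalerA mulrN1 h4; apply.
  have h5 : is_derive s 1 (fun s : R => 2 * q * s ^+ 2) (4 * q * s).
    have -> : (fun s : R => 2 * q * s ^+ 2) = (2 * q) \*: ((id : R -> R) ^+ 2).
      by apply/funext => r; rewrite /= exprfctE.
    apply: is_derive_eq (is_deriveZ _ (is_deriveX 2 (is_derive_id s (1 : R)))) _.
    by rewrite /GRing.scale/= expr1; ring.
  exact: is_derive_eq (is_deriveB (is_deriveD h1 h2) h5) _.
have cg A : {within A, continuous g}.
  apply: continuous_subspaceT => s.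
  by apply/differentiable_continuous/derivable1_diffP; have [] := dg s.
have [s] := MVT m0 (fun s _ => dg s) (cg _).
rewrite in_itv/= => /andP[s0 sm] E.
have := H m; rewrite (ger0_norm (ltW m0)) => /(_ md) Hp.
have := H (- m); rewrite normrN (ger0_norm (ltW m0)) => /(_ md) Hm.
have gm : g m - g 0 <= 0.
  by rewrite /g oppr0 scale0r addr0 expr0n/=; move: Hp Hm; rewrite sqrrN; lra.
have sd' : s < d' by rewrite (lt_trans sm).
have := H' s; rewrite gt_eqF// (ger0_norm (ltW s0)) => /(_ isT sd').
have := H' (- s); rewrite oppr_eq0 gt_eqF// normrN (ger0_norm (ltW s0)) => /(_ isT sd').
rewrite -/(D s) -/(D (- s)) !ltr_norml => /andP[A1 _] /andP[A2 _].
have : 0 < g' s.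
  rewrite /g'.
  have B1 : (2 * q) * s < D s - 'D_v f x.
    by rewrite mulrC -ltr_pdivlMl//; rewrite /e in A2; lra.
  have B2 : (2 * q) * s < 'D_v f x - D (- s).
    rewrite mulrC -ltr_pdivlMl//; rewrite /e invrN mulNr in A1; lra.
  by lra.
move=> g's; have : 0 < g' s * (m - 0) by rewrite mulr_gt0// subr0.
by rewrite -E ltNge gm.
Qed.
Lemma derive_norm_le f x v (M d : R) : derivable f x v -> 0 < d ->
  (forall h : R, 0 < h < d -> `|f (x + h *: v) - f x| <= h * M) ->
  `|'D_v f x| <= M.
Proof.
move=> df d0 H; rewrite ler_norml lerNl; apply/andP; split.
  rewrite -deriveN//; apply: (derive_le (derivableN df) d0) => h hd.
  have := H h hd; rewrite ler_norml => /andP[+ _].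
  rewrite -[(- f) _]/(- f _) -[(- f) _]/(- f _); lra.
apply: (derive_le df d0) => h hd.
by have := H h hd; rewrite ler_norml => /andP[].
Qed.

(** Completeness of the reals gives the limit of the quotients; letting [h'] tend to 0 in the Cauchy
    estimate gives the rate of convergence. *)
Lemma derivable_cauchy f x v (L d : R) (q : R -> R) : 0 < d -> 0 < L ->
  (forall h, q h = h^-1 * (f (x + h *: v) - f x)) ->
  (forall h h', h != 0 -> `|h| < d -> h' != 0 -> `|h'| < d ->
    `|q h - q h'| <= L * (`|h| + `|h'|)) ->
  derivable f x v /\
  forall h, h != 0 -> `|h| < d -> `|q h - 'D_v f x| <= L * `|h|.
Proof.
move=> d0 L0 qE H.
have df : derivable f x v.
  rewrite /derivable.
  have -> : (fun h => h^-1 *: ((f \o shift x) (h *: v) - f x)) = q.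
    by apply/funext => h; rewrite qE /= [h *: v + x]addrC.
  apply/cauchy_cvgP/cauchyP => e e0.
  pose r := Num.min d (e / (4 * L)).
  have r0 : 0 < r by rewrite lt_min d0 divr_gt0// mulr_gt0.
  exists (q (r / 2)); exists r => //= h.
  rewrite /= sub0r normrN lt_min => /andP[hd he] h0.
  have k0 : 0 < r / 2 by rewrite divr_gt0.
  have : r / 2 < r by lra.
  rewrite {2}/r lt_min => /andP[kd ke].
  have Hk : `|r / 2| = r / 2 by rewrite ger0_norm// ltW.
  have := H (r / 2) h; rewrite gt_eqF// Hk => /(_ isT kd h0 hd).
  rewrite -ball_normE/= => /le_lt_trans; apply.
  rewrite mulrC -ltr_pdivlMr//.
  have -> : e / L = 4 * (e / (4 * L)) by field; rewrite gt_eqF.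
  lra.
split=> // h h0 hd; apply/ler_addgt0Pr => e e0.
have e20 : 0 < e / 2 by rewrite divr_gt0.
have [d' d'0 H'] := derivable_diff_quotient df e20.
pose m := Num.min (Num.min d d') (e / (2 * L)).
have m0 : 0 < m by rewrite !lt_min d0 d'0 divr_gt0// mulr_gt0.
have : m / 2 < m by lra.
rewrite {2}/m !lt_min => /andP[/andP[md md'] me].
have k0 : 0 < m / 2 by rewrite divr_gt0.
set k := m / 2 in md md' me k0.
have := H' k; rewrite gt_eqF// (ger0_norm (ltW k0)) -qE => /(_ isT md') H1.
have := H h k h0 hd; rewrite gt_eqF// (ger0_norm (ltW k0)) => /(_ isT md) H2.
move: me; rewrite ltr_pdivlMr ?mulr_gt0// => me.
have := ler_normD (q h - q k) (q k - 'D_v f x).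
rewrite addrA subrK => /le_trans; apply.
rewrite (le_trans (lerD H2 (ltW H1)))//; lra.
Qed.

Lemma continuous_distP f x : {for x, continuous f} <->
  (forall e, 0 < e -> exists2 r : R, 0 < r &
     forall y, `|y - x| < r -> `|f y - f x| < e).
Proof.
split=> [/cvgrPdist_lt cf e /cf/nbhs_normP[r r0 H]|H].
  by exists r => // y yr; rewrite distrC; apply: H; rewrite /= distrC.
apply/cvgrPdist_lt => e /H[r r0 {}H]; apply/nbhs_normP; exists r => //= y.
by rewrite /= => yr; rewrite distrC; apply: H; rewrite distrC.
Qed.
End Lines.

(** * Calculus on row vectors *)

Section RowVectors.
Context {R : realType} {d : nat}.
Local Notation V := 'rV[R]_d.
Implicit Types (f g u : V -> R) (x y : V) (i j k : 'I_d).

Lemma rV_norm_leP x (r : R) : 0 <= r ->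
  reflect (forall i, `|x 0 i| <= r) (`|x| <= r).
Proof.
move=> r0; have -> : `|x| = \big[Num.max/0]_ij `|x ij.1 ij.2| by exact: mx_normrE.
apply: (iffP (bigmax_leP _ _ _ _)) => [[_ H] i|H]; first exact: (H (0, i)).
by split=> // -[a i] _ /=; rewrite [a]ord1.
Qed.

Lemma rV_coord_le x i : `|x 0 i| <= `|x|.
Proof. exact: (rV_norm_leP x (normr_ge0 x) _). Qed.

Lemma rV_norm_delta_le i : `|'e_i : V| <= 1.
Proof.
apply/rV_norm_leP => // j; rewrite mxE eqxx /=.
by case: (j == i); rewrite ?normr1 ?normr0.
Qed.

Lemma rV_norm_scale_delta (s : R) i : `|s *: 'e_i : V| <= `|s|.
Proof. by rewrite normrZ ler_piMr// rV_norm_delta_le. Qed.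

Lemma compact_ball_bounded f x (r : R) : continuous f ->
  exists2 M, 0 < M & forall y, `|y - x| <= r -> `|f y| <= M.
Proof.
move=> cf.
have cK : compact [set y : V | `|y - x| <= r].
  apply: bounded_closed_compact.
    exists (r + `|x|); split; first exact: num_real.
    move=> M rM y /= yr; rewrite -(subrK x y).
    by rewrite (le_trans (ler_normD _ _))// (le_trans _ (ltW rM))// lerD2r.
  have -> : [set y : V | `|y - x| <= r] =
      (fun y => `|y - x|) @^-1` [set s : R | s <= r] by [].
  apply: preimage_closed; last exact: closed_le.
  move=> y _; apply: (@continuous_comp _ _ _ (fun y => y - x) (fun z => `|z|)).
    by apply: (@continuousB _ _ _ (fun y => y) (fun=> x)); [exact: cvg_id|exact: cst_continuous].
  exact: norm_continuous.
have : bounded_set (f @` [set y : V | `|y - x| <= r]).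
  apply: compact_bounded; apply: continuous_compact cK.
  exact: continuous_subspaceT.
move=> /ex_strict_bound_gt0[M M0 H]; exists M => // y yr.
by apply: ltW; apply: H; exists y.
Qed.

Lemma C1_deriv f i x : C1 f -> derivable f x 'e_i.
Proof. by move=> /(_ i)[]. Qed.
Arguments C1_deriv {f} i x _.

Lemma C1_MVT f x i (t : R) : C1 f -> exists2 s, `|s| <= `|t| &
  f (x + t *: 'e_i) - f x = t * partial i f (x + s *: 'e_i).
Proof. by move=> Cf; apply: MVT_line => s; exact: C1_deriv. Qed.

(** The partial derivatives are bounded near [x], so moving from [x] to [y] one coordinate at a time
    and applying the mean value theorem to each move gives a Lipschitz bound at [x]. *)
Lemma C1_continuous f : C1 f -> continuous f.
Proof.
move=> Cf x.
have [M M0 HM] : exists2 M, 0 < M &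
    forall i y, `|y - x| <= 1 -> `|partial i f y| <= M.
  have : forall i, exists M, 0 < M /\
      forall y, `|y - x| <= 1 -> `|partial i f y| <= M.
    move=> i; have [_ ci] := Cf i.
    by have [M M0 HM] := compact_ball_bounded x 1 ci; exists M.
  move=> /choice[M HM]; exists (1 + \sum_i M i).
    by rewrite ltr_pwDl// sumr_ge0// => i _; have [/ltW] := HM i.
  move=> i y yx; have [_ H] := HM i; apply: (le_trans (H y yx)).
  rewrite (bigD1 i)//= addrCA lerDl addr_ge0// sumr_ge0// => j _.
  by have [/ltW] := HM j.
suff Lip y : `|y - x| <= 1 -> `|f y - f x| <= d%:R * M * `|y - x|.
  apply/continuous_distP => e e0; pose L := d%:R * M + 1.
  have L0 : 0 < L by rewrite ltr_wpDl// mulr_ge0// ltW.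
  exists (Num.min 1 (e / L)) => [|y]; first by rewrite lt_min ltr01 divr_gt0.
  rewrite lt_min => /andP[y1 ye]; rewrite (le_lt_trans (Lip _ (ltW y1)))//.
  apply: (@le_lt_trans _ _ (`|y - x| * L)); last by rewrite -ltr_pdivlMr.
  by rewrite mulrC ler_wpM2l// lerDl.
(* Path from [x] to [y] that replaces the coordinates in order. In the sup norm it stays in the unit
   ball around [x], and so do the mean value points. *)
move=> yx; pose z m : V := \row_j (if (j < m)%N then y 0 j else x 0 j).
suff Hz m : (m <= d)%N -> `|f (z m) - f x| <= m%:R * M * `|y - x|.
  have := Hz d (leqnn d).
  by have -> : z d = y by apply/rowP => j; rewrite mxE ltn_ord.
elim: m => [_|m IH md].
  have -> : z 0 = x by apply/rowP => j; rewrite mxE.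
  by rewrite subrr normr0 !mul0r.
pose i := Ordinal md.
have zS : z m.+1 = z m + (y 0 i - x 0 i) *: 'e_i.
  apply/rowP => j; rewrite !mxE eqxx/= ltnS leq_eqVlt.
  have -> : (j == m :> nat) = (j == i) by [].
  have [->|_] /= := eqVneq j i; last by rewrite mulr0 addr0.
  by rewrite ltnn mulr1 addrC subrK.
have [s sl E] := C1_MVT (z m) i (y 0 i - x 0 i) Cf.
rewrite zS -(subrK (f (z m)) (f _)) -addrA E.
have -> : m.+1%:R * M * `|y - x| = `|y - x| * M + m%:R * M * `|y - x|.
  by rewrite mulrS; ring.
rewrite (le_trans (ler_normD _ _))// lerD ?IH ?(ltnW md)// normrM.
have yi : `|y 0 i - x 0 i| <= `|y - x|.
  by have := rV_coord_le (y - x) i; rewrite !mxE.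
rewrite ler_pM// HM//.
apply: le_trans yx; apply/rV_norm_leP => // j; rewrite !mxE eqxx/=.
have [->|ji] := eqVneq j i.
  by rewrite ltnn mulr1 addrAC subrr add0r (le_trans sl).
rewrite mulr0 addr0; case: ifP => _; last by rewrite subrr normr0.
by have := rV_coord_le (y - x) j; rewrite !mxE.
Qed.

Lemma partial_lin (a b : R) f g i : C1 f -> C1 g ->
  partial i (fun x => a * f x + b * g x) =
  (fun x => a * partial i f x + b * partial i g x).
Proof.
move=> Cf Cg; apply/funext => x.
have df := is_deriveZ a (derivableP (C1_deriv i x Cf)).
have dg := is_deriveZ b (derivableP (C1_deriv i x Cg)).
by have [_ <-] := is_deriveD df dg.
Qed.

Lemma continuous_lin (a b : R) f g : continuous f -> continuous g ->
  continuous (fun x => a * f x + b * g x).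
Proof.
move=> cf cg x.
apply: (@continuousD _ _ _ (fun x => a * f x) (fun x => b * g x)).
  by apply: (@continuousM _ _ (fun=> a) f); [exact: cst_continuous|exact: cf].
by apply: (@continuousM _ _ (fun=> b) g); [exact: cst_continuous|exact: cg].
Qed.

Lemma C1_lin (a b : R) f g : C1 f -> C1 g -> C1 (fun x => a * f x + b * g x).
Proof.
move=> Cf Cg i; split=> [x|].
  have df := is_deriveZ a (derivableP (C1_deriv i x Cf)).
  have dg := is_deriveZ b (derivableP (C1_deriv i x Cg)).
  by have [] := is_deriveD df dg.
rewrite (partial_lin a b i Cf Cg).
by apply: continuous_lin; [exact: (Cf i).2|exact: (Cg i).2].
Qed.

Lemma C2_lin (a b : R) f g : C2 f -> C2 g -> C2 (fun x => a * f x + b * g x).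
Proof.
move=> [Cf CCf] [Cg CCg]; split; first exact: C1_lin.
by move=> i; rewrite (partial_lin a b i Cf Cg); exact: C1_lin (CCf i) (CCg i).
Qed.

Lemma partial2_lin (a b : R) f g i j : C2 f -> C2 g ->
  partial j (partial i (fun x => a * f x + b * g x)) =
  (fun x => a * partial j (partial i f) x + b * partial j (partial i g) x).
Proof.
move=> [Cf CCf] [Cg CCg]; rewrite (partial_lin a b i Cf Cg).
exact: partial_lin (CCf i) (CCg i).
Qed.

Lemma harmonic_lin (a b : R) f g : harmonic f -> harmonic g ->
  harmonic (fun x => a * f x + b * g x).
Proof.
move=> [Cf lf] [Cg lg]; split; first exact: C2_lin.
move=> x; transitivity (a * laplacian f x + b * laplacian g x).
  rewrite /laplacian !mulr_sumr -big_split; apply: eq_bigr => i _.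
  by rewrite (partial2_lin a b i i Cf Cg).
by rewrite lf lg !mulr0 addr0.
Qed.

(* Covers both translations (c = 1) and reflections (c k = -1). *)
Definition axis_map (c : 'I_d -> R) (T : V -> V) :=
  continuous T /\ forall i x (h : R), T (x + h *: 'e_i) = T x + h *: (c i *: 'e_i).

Lemma partial_axis_map c T f i : axis_map c T -> C1 f ->
  partial i (f \o T) = (fun x => c i * partial i f (T x)).
Proof.
move=> [cT TE] Cf; apply/funext => x.
have [] // := is_derive_affine (TE i x) (is_derive_scale (c i) (C1_deriv i _ Cf)).
Qed.

Lemma C1_axis_map c T f : axis_map c T -> C1 f -> C1 (f \o T).
Proof.
move=> cT Cf i; split=> [x|].
  by have [] := is_derive_affine (cT.2 i x) (is_derive_scale (c i) (C1_deriv i _ Cf)).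
rewrite (partial_axis_map i cT Cf) => x.
apply: (@continuousM _ _ (fun=> c i) (partial i f \o T)).
  exact: cst_continuous.
by apply: (@continuous_comp _ _ _ T (partial i f)); [exact: cT.1|exact: (Cf i).2].
Qed.

Lemma C2_axis_map c T f : axis_map c T -> C2 f -> C2 (f \o T).
Proof.
move=> cT [Cf CCf]; split=> [|i]; first exact: C1_axis_map cT Cf.
rewrite (partial_axis_map i cT Cf).
(* A zero second term is added so that the lemma on two-term linear combinations applies. *)
have -> : (fun x => c i * partial i f (T x)) =
    (fun x => c i * (partial i f \o T) x + 0 * (partial i f \o T) x).
  by apply/funext => x; rewrite mul0r addr0.
have CT := C1_axis_map cT (CCf i).
exact: (C1_lin _ _ CT CT).
Qed.

Lemma partial2_axis_map c T f i j : axis_map c T -> C2 f ->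
  partial j (partial i (f \o T)) =
  (fun x => c i * c j * partial j (partial i f) (T x)).
Proof.
move=> cT [Cf CCf]; rewrite (partial_axis_map i cT Cf).
have -> : (fun x => c i * partial i f (T x)) =
    (fun x => c i * (partial i f \o T) x + 0 * (partial i f \o T) x).
  by apply/funext => x; rewrite mul0r addr0.
have CT := C1_axis_map cT (CCf i).
rewrite (partial_lin (c i) 0 j CT CT) (partial_axis_map j cT (CCf i)).
by apply/funext => x; rewrite mul0r addr0 mulrA.
Qed.

Lemma harmonic_axis_map c T f : axis_map c T -> (forall i, c i * c i = 1) ->
  harmonic f -> harmonic (f \o T).
Proof.
move=> cT c1 [Cf lf]; split; first exact: C2_axis_map cT Cf.
move=> x; rewrite -[RHS](lf (T x)); apply: eq_bigr => i _.
by rewrite (partial2_axis_map i i cT Cf) c1 mul1r.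
Qed.

Lemma axis_map_shift (a : V) : axis_map (fun=> 1) (fun x => x + a).
Proof.
split=> [x|i x h]; last by rewrite scale1r addrAC.
by apply: (@continuousD _ _ _ (fun y => y) (fun=> a)); [exact: cvg_id|exact: cst_continuous].
Qed.

Lemma axis_map_reflect k :
  axis_map (fun i => if i == k then -1 else 1) (fun x => x - (2 * x 0 k) *: 'e_k).
Proof.
split=> [x|i x h].
  apply: (@continuousB _ _ _ (fun y => y) (fun y => (2 * y 0 k) *: 'e_k)); first exact: cvg_id.
  apply: (@continuousZr_tmp _ _ _ (fun x : V => 2 * x 0 k)).
  by apply: continuousM; [exact: cst_continuous|exact: coord_continuous].
apply/rowP => j; rewrite !mxE !eqxx/= [k == i]eq_sym.
have [->|_] := eqVneq i k; last by rewrite /=; ring.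
by rewrite /=; ring.
Qed.
End RowVectors.
Arguments C1_deriv {R d f} i x _.

(** * Interior estimates and regularity *)

Section Estimates.
Context {R : realType} {d : nat}.
Local Notation V := 'rV[R]_d.
Implicit Types (f g u : V -> R) (x y : V) (i j k : 'I_d).

Local Notation C := (d.+1%:R : R).

(* Normalised so that its Laplacian is 2 d - 2 (d + 1) = -2. *)
Definition barrier k x : R :=
  \sum_j x 0 j ^+ 2 + C * x 0 k * (1 - x 0 k).

Lemma barrier_continuous k : continuous (barrier k).
Proof.
have cc j : continuous (fun x : V => x 0 j) by exact: coord_continuous.
have -> : barrier k = (\sum_j (fun x : V => x 0 j * x 0 j)) +
    (fun x => C * x 0 k * (1 - x 0 k)).
  apply/funext => x; rewrite /barrier -[RHS]/(_ + _) fct_sumE.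
  by congr (_ + _); apply: eq_bigr => j _; rewrite expr2.
move=> x; apply: continuousD.
  elim/big_ind: _ => [|f g cf cg|j _]; first exact: cst_continuous.
    exact: continuousD.
  by apply: continuousM; exact: cc.
apply: (@continuousM _ _ (fun x => C * x 0 k) (fun x => 1 - x 0 k)).
  by apply: continuousM; [exact: cst_continuous|exact: cc].
have := @continuousB _ R^o V (fun=> 1) (fun x => x 0 k) x.
by apply; [exact: cst_continuous|exact: cc].
Qed.

(** The barrier is a quadratic polynomial, so its second-order expansion along an axis is exact;
    this supplies the parabola for [derive2_le]. *)
Lemma barrier_line k i x (t : R) : barrier k (x + t *: 'e_i) - barrier k x =
  (2 * x 0 i + C * (i == k)%:R * (1 - 2 * x 0 k)) * t +
  (1 - C * (i == k)%:R) * t ^+ 2.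
Proof.
rewrite /barrier (bigD1 i)//= [in X in _ - X](bigD1 i)//= !mxE !eqxx/=.
under eq_bigr => j ji do rewrite !mxE eqxx/= (negbTE ji) mulr0 addr0.
rewrite [k == i]eq_sym; have [->|_] := eqVneq i k; rewrite /=; ring.
Qed.

Lemma barrier_ge0 k x : 0 <= x 0 k <= 1 -> 0 <= barrier k x.
Proof.
move=> /andP[x0 x1]; rewrite addr_ge0//.
  by apply: sumr_ge0 => j _; exact: sqr_ge0.
by rewrite !mulr_ge0// subr_ge0.
Qed.

Lemma barrier_ge1 k x j : 0 <= x 0 k <= 1 -> `|x 0 j| = 1 -> 1 <= barrier k x.
Proof.
move=> /andP[x0 x1] xj; rewrite -[leLHS]addr0 lerD//; last first.
  by rewrite !mulr_ge0// subr_ge0.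
rewrite (bigD1 j)//= -[X in _ <= X + _]real_normK ?num_real// xj expr1n lerDl.
by apply: sumr_ge0 => i _; exact: sqr_ge0.
Qed.

(** Maximum principle on the half cube. A positive maximum of [f - M * barrier k] can lie neither on
    the outer faces, where the barrier is at least 1, nor on the flat face, where [f] vanishes. At
    an interior maximum the second partials of [f] are at most [M] times those of the barrier, and
    summing them gives [0 <= - (2 * M)]. *)
Lemma barrier_comparison k f (M : R) : 0 < M -> harmonic f ->
  (forall x, `|x| <= 1 -> f x <= M) -> (forall x, x 0 k = 0 -> f x = 0) ->
  forall x, `|x| <= 1 -> 0 <= x 0 k -> f x <= M * barrier k x.
Proof.
move=> M0 [Cf lf] fM f0 x x1 xk; rewrite -subr_le0 leNgt; apply/negP => Fx.
pose F y := f y - M * barrier k y.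
pose K := [set y : V | `|y| <= 1] `&` [set y : V | 0 <= y 0 k].
have cK : compact K.
  apply: bounded_closed_compact.
    exists 1; split; first exact: num_real.
    by move=> r r1 y [/= y1 _]; rewrite (le_trans y1)// ltW.
  apply: closedI.
    apply: (@preimage_closed _ _ (fun y : V => `|y|) [set s : R | s <= 1]).
      by move=> y _; exact: norm_continuous.
    exact: closed_le.
  apply: (@preimage_closed _ _ (fun y : V => y 0 k) [set s : R | 0 <= s]).
    by move=> y _; exact: coord_continuous.
  exact: closed_ge.
have cF : continuous F.
  move=> y; apply: (@continuousB _ _ _ f (fun y => M * barrier k y)).
    exact: (C1_continuous Cf.1).
  apply: (@continuousM _ _ (fun=> M) (barrier k)); first exact: cst_continuous.
  exact: barrier_continuous.
have [] := @EVT_max_rV _ _ F K _ cK (continuous_subspaceT cF).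
  by exists x.
move=> p; rewrite inE => -[/= p1 pk] Fmax.
have {}Fmax y : `|y| <= 1 -> 0 <= y 0 k -> F y <= F p.
  by move=> y1 yk; apply: Fmax; rewrite inE.
have Fp : 0 < F p by rewrite (lt_le_trans Fx)// Fmax.
have pi1 i : `|p 0 i| <= 1 by rewrite (le_trans (rV_coord_le p i)).
have pk1 : 0 <= p 0 k <= 1 by rewrite pk (le_trans (ler_norm _) (pi1 k)).
have {}pi1 i : `|p 0 i| < 1.
  rewrite lt_neqAle pi1 andbT; apply/eqP => E; move: Fp; apply/negP.
  rewrite -leNgt subr_le0 (le_trans (fM p p1))// ler_peMr ?(ltW M0)//.
  exact: barrier_ge1 E.
have {}pk : 0 < p 0 k.
  rewrite lt_neqAle pk andbT; apply/eqP => E; move: Fp; apply/negP.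
  by rewrite -leNgt subr_le0 f0// mulr_ge0 ?(ltW M0)// barrier_ge0.
have H i : partial i (partial i f) p <= 2 * (M * (1 - C * (i == k)%:R)).
  (* Within this distance of [p] along the [i]-th axis one stays in the half cube. *)
  have d0 : 0 < Num.min (1 - `|p 0 i|) (p 0 k) by rewrite lt_min subr_gt0 pi1.
  apply: (derive2_le (b := M * (2 * p 0 i + C * (i == k)%:R * (1 - 2 * p 0 k)))
    _ _ d0) => [s||t].
  - exact: C1_deriv Cf.1.
  - exact: C1_deriv (Cf.2 i).
  rewrite lt_min => /andP[t1 tk].
  have : F (p + t *: 'e_i) <= F p.
    apply: Fmax.
      apply/rV_norm_leP => // j; rewrite !mxE eqxx/=.
      have [->|_] := eqVneq j i; last by rewrite mulr0 addr0 ltW.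
      rewrite mulr1 (le_trans (ler_normD _ _))//; lra.
    rewrite !mxE eqxx/=; case: (k == i); rewrite ?mulr0 ?addr0 ?(ltW pk)//.
    by rewrite mulr1; have := ler_norm (- t); rewrite normrN; lra.
  have := barrier_line k i p t.
  rewrite /F => /(congr1 (fun z => M * z)); lra.
have : laplacian f p <= \sum_i (2 * (M * (1 - C * (i == k)%:R))).
  by apply: ler_sum => i _; exact: H.
rewrite lf -mulr_sumr -mulr_sumr sumrB sumr_const card_ord.
rewrite (bigD1 k)//= eqxx big1 => [|i /negbTE ->]; last by rewrite mulr0.
have -> : 2 * (M * (1 *+ d - (C * 1 + 0))) = - (2 * M).
  by rewrite -natr1; ring.
by rewrite oppr_ge0 leNgt mulr_gt0.
Qed.
End Estimates.

(** * Derivative bounds, third derivatives and symmetry of mixed partials *)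

Section Regularity.
Context {R : realType} {d : nat}.
Local Notation V := 'rV[R]_d.
Implicit Types (f g u : V -> R) (x y : V) (i j k : 'I_d).

Local Notation C := (d.+1%:R : R).

Lemma harmonic_shift (a : V) u : harmonic u -> harmonic (u \o (fun x => x + a)).
Proof. by apply: (harmonic_axis_map (axis_map_shift a)) => i; rewrite mulr1. Qed.

Lemma partial_harmonic0_le k u (M : R) : 0 < M -> harmonic u ->
  (forall y, `|y| <= 1 -> `|u y| <= M) -> partial k u 0 <= C * M.
Proof.
move=> M0 hu uM.
have rk := @axis_map_reflect R d k.
set T := (fun x : V => x - _) in rk.
have hT : harmonic (u \o T).
  apply: harmonic_axis_map rk _ hu => i.
  by case: ifP => _; rewrite ?mulrNN mulr1.
pose f x := 1 * u x + (-1) * (u \o T) x.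
have hf : harmonic f by exact: harmonic_lin.
have Tball x : `|x| <= 1 -> `|T x| <= 1.
  move=> x1; apply/rV_norm_leP => // j; rewrite !mxE eqxx/=.
  have := rV_coord_le x j; have [->|_] := eqVneq j k => xj.
    have -> : x 0 k - 2 * x 0 k * 1%:R = - x 0 k by ring.
    by rewrite normrN (le_trans xj).
  by rewrite mulr0 subr0 (le_trans xj).
have fM x : `|x| <= 1 -> f x <= 2 * M.
  move=> x1; have := uM _ x1; have := uM _ (Tball _ x1).
  by rewrite /f /= !ler_norml => /andP[? ?] /andP[? ?]; lra.
have f0 x : x 0 k = 0 -> f x = 0.
  move=> xk; have E : T x = x by rewrite /T xk mulr0 scale0r subr0.
  by rewrite /f /= E; ring.
have M20 : 0 < 2 * M by rewrite mulr_gt0.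
have H := barrier_comparison M20 hf fM f0.
(* The reflection reverses the sign of the [k]-th partial derivative, so the two contributions add
   up. *)
have df : partial k f 0 = 2 * partial k u 0.
  have CT := C1_axis_map rk hu.1.1.
  rewrite (partial_lin 1 (-1) k hu.1.1 CT) (partial_axis_map k rk hu.1.1).
  by rewrite eqxx /T mxE mulr0 scale0r subr0; ring.
have : partial k f 0 <= 2 * M * C.
  apply: (derive_le (C1_deriv k 0 hf.1.1) ltr01) => h /andP[h0 h1].
  rewrite [f 0]f0 ?mxE// subr0.
  have hk : (h *: 'e_k : V) 0 k = h by rewrite !mxE !eqxx mulr1.
  have := H (0 + h *: 'e_k).
  have hn : `|h *: 'e_k : V| <= 1.
    by rewrite (le_trans (rV_norm_scale_delta h k))// ger0_norm ltW.
  rewrite add0r hk => /(_ hn (ltW h0)) /le_trans; apply.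
  (* The barrier at [h *: 'e_k] equals [C * h - d%:R * h ^+ 2], hence is at most [C * h]. *)
  have := barrier_line k k 0 h; rewrite add0r.
  have -> : barrier k 0 = 0 :> R.
    rewrite /barrier big1 => [|j _]; first by rewrite mxE; ring.
    by rewrite mxE expr0n.
  rewrite !mxE eqxx subr0 => ->.
  rewrite [leRHS](_ : _ = 2 * M * (C * h)); last by ring.
  rewrite ler_pM2l// -natr1.
  have : 0 <= d%:R * h ^+ 2 by rewrite mulr_ge0// sqr_ge0.
  by rewrite /=; lra.
by rewrite df; lra.
Qed.

Lemma partial_harmonic_le k u x (M : R) : 0 < M -> harmonic u ->
  (forall y, `|y - x| <= 1 -> `|u y| <= M) -> `|partial k u x| <= C * M.
Proof.
move=> M0 hu uM.
have hs := harmonic_shift x hu.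
have ps : partial k (u \o (fun y => y + x)) 0 = partial k u x.
  by rewrite (partial_axis_map k (axis_map_shift x) hu.1.1) mul1r add0r.
rewrite ler_norml lerNl; apply/andP; split.
  (* The lower bound is the upper bound for the negative of the translated function. *)
  have hn := harmonic_lin (-1) 0 hs hs.
  have := partial_harmonic0_le k M0 hn.
  rewrite (partial_lin (-1) 0 k hs.1.1 hs.1.1) ps mul0r addr0 mulN1r; apply.
  move=> y y1; rewrite mul0r addr0 mulN1r normrN; apply: uM.
  by rewrite addrK.
rewrite -ps; apply: partial_harmonic0_le => // y y1.
by apply: uM; rewrite addrK.
Qed.

(* An explicit linear combination, so that the lemmas on those apply as they are. *)
Definition diff_quotient i (h : R) f x : R :=
  h^-1 * (f \o (fun y => y + h *: 'e_i)) x + (- h^-1) * f x.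

Lemma diff_quotientE i h f x :
  diff_quotient i h f x = h^-1 * (f (x + h *: 'e_i) - f x).
Proof. by rewrite /diff_quotient mulrBr mulNr. Qed.

Lemma continuous_diff_quotient i h f :
  continuous f -> continuous (diff_quotient i h f).
Proof.
move=> cf; have cs : continuous (f \o (fun y => y + h *: 'e_i)).
  move=> y; apply: (@continuous_comp _ _ _ (fun y => y + h *: 'e_i) f).
    exact: (axis_map_shift _).1.
  exact: cf.
exact: (@continuous_lin R d h^-1 (- h^-1) _ _ cs cf).
Qed.

Lemma partial_diff_quotient i j h f : C1 f ->
  partial j (diff_quotient i h f) = diff_quotient i h (partial j f).
Proof.
move=> Cf; have Cs := C1_axis_map (axis_map_shift (h *: 'e_i)) Cf.
rewrite (partial_lin _ _ j Cs Cf) (partial_axis_map j (axis_map_shift _) Cf).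
by apply/funext => x; rewrite mul1r.
Qed.

Lemma harmonic_diff_quotient i h u : harmonic u -> harmonic (diff_quotient i h u).
Proof. by move=> hu; exact: (harmonic_lin _ _ (harmonic_shift _ hu) hu). Qed.

(** Harmonicity of [partial k u] is not yet available, so the first-order bound is applied to
    difference quotients of [u], themselves bounded by [C * M]. The radius 3 allows 1 for each of
    the two applications and 1 for the step. *)
Lemma partial2_harmonic_le j k u x (M : R) : 0 < M -> harmonic u ->
  (forall y, `|y - x| <= 3 -> `|u y| <= M) ->
  `|partial j (partial k u) x| <= C * (C * M).
Proof.
move=> M0 hu uM.
have CM0 : 0 < C * M by rewrite mulr_gt0.
apply: (derive_norm_le (C1_deriv j x (hu.1.2 k)) ltr01) => h /andP[h0 h1].
have := partial_harmonic_le k CM0 (harmonic_diff_quotient j h hu) (x := x).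
rewrite (partial_diff_quotient j k h hu.1.1) diff_quotientE.
rewrite normrM normfV (ger0_norm (ltW h0)) ler_pdivrMl//; apply=> y yx.
rewrite diff_quotientE; have [s sh ->] := C1_MVT y j h hu.1.1.
rewrite mulKf ?gt_eqF//; apply: partial_harmonic_le => // z zy.
apply: uM; have -> : z - x = (z - (y + s *: 'e_j)) + (y - x) + s *: 'e_j.
  by apply/rowP => a; rewrite !mxE; ring.
have := rV_norm_scale_delta s j.
have := ler_normD (z - (y + s *: 'e_j)) (y - x).
have := ler_normD (z - (y + s *: 'e_j) + (y - x)) (s *: 'e_j).
by rewrite (ger0_norm (ltW h0)) in sh; lra.
Qed.

(** Two mean value steps: the quotient is a partial derivative at a point shifted by at most [h],
    and that shift costs a second derivative times its length. *)
Lemma diff_quotient_partial_le i f x (h K r : R) : C2 f -> h != 0 -> `|h| <= 1 ->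
  (forall y, `|y - x| <= r + 1 -> `|partial i (partial i f) y| <= K) ->
  forall y, `|y - x| <= r ->
  `|diff_quotient i h f y - partial i f y| <= K * `|h|.
Proof.
move=> Cf h0 h1 HK y yx; rewrite diff_quotientE.
have [s sh ->] := C1_MVT y i h Cf.1; rewrite mulKf//.
have [t ts ->] := C1_MVT y i s (Cf.2 i).
rewrite normrM mulrC ler_pM//; apply: HK.
rewrite addrAC (le_trans (ler_normD _ _))// lerD//.
by rewrite (le_trans (rV_norm_scale_delta _ _))// (le_trans ts)// (le_trans sh).
Qed.

Lemma norm_sub_lt_approx (a b p q r s e : R) :
  `|a - p| <= r -> `|b - q| <= r -> `|a - b| < s -> 2 * r + s <= e ->
  `|p - q| < e.
Proof.
rewrite !ler_norml !ltr_norml.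
by move=> /andP[? ?] /andP[? ?] /andP[? ?] ?; apply/andP; split; lra.
Qed.

Lemma harmonic_C3 u j k : harmonic u -> C1 (partial j (partial k u)).
Proof.
move=> hu i; set g := partial j (partial k u).
have Lip x0 : exists2 L, 0 < L & forall x, `|x - x0| <= 1 ->
    forall h h', h != 0 -> `|h| < 1 -> h' != 0 -> `|h'| < 1 ->
    `|diff_quotient i h g x - diff_quotient i h' g x| <= L * (`|h| + `|h'|).
  (* Here 4 is 1 for [x] plus 3 for the second-derivative bound at [x]; the last 1 is for the step
     of the quotient. *)
  have [K K0 HK] := compact_ball_bounded x0 (4 + 1) ((hu.1.2 i) i).2.
  exists (C * (C * K)) => [|x xx0 h h' h0 h1 h'0 h'1]; first by rewrite !mulr_gt0.
  have hh0 : 0 < `|h| + `|h'| by rewrite ltr_wpDl// normr_gt0.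
  have hd := harmonic_diff_quotient i h hu.
  have hd' := harmonic_diff_quotient i h' hu.
  pose w := fun x => 1 * diff_quotient i h u x + (-1) * diff_quotient i h' u x.
  have hw : harmonic w by exact: harmonic_lin.
  have wE : partial j (partial k w) x =
      diff_quotient i h g x - diff_quotient i h' g x.
    rewrite (partial2_lin 1 (-1) k j hd.1 hd'.1).
    rewrite !(partial_diff_quotient i k _ hu.1.1).
    rewrite !(partial_diff_quotient i j _ (hu.1.2 k)).
    by rewrite mul1r mulN1r.
  rewrite -wE -!mulrA; apply: partial2_harmonic_le => //.
    by rewrite mulr_gt0.
  move=> y yx; rewrite /w mul1r mulN1r.
  have yx0 : `|y - x0| <= 4.
    have := ler_normD (y - x) (x - x0); rewrite addrA subrK; lra.
  have := diff_quotient_partial_le hu.1 h0 (ltW h1) HK yx0.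
  have := diff_quotient_partial_le hu.1 h'0 (ltW h'1) HK yx0.
  rewrite distrC => A B; have := lerD B A; rewrite -mulrDr; apply: le_trans.
  by have := ler_normD (diff_quotient i h u y - partial i u y)
    (partial i u y - diff_quotient i h' u y); rewrite addrA subrK.
have dq x (L : R) (L0 : 0 < L) := @derivable_cauchy R _ g x 'e_i L 1
  (fun h => diff_quotient i h g x) ltr01 L0 (fun h => diff_quotientE i h g x).
split=> [x|x0].
  have [L L0 /(_ x)] := Lip x; rewrite subrr normr0 => /(_ ler01) H.
  by have [] := dq x L L0 H.
(* Continuity follows by uniform approximation: for one fixed small [h] the quotient of [g] is
   continuous and within [L * h] of the derivative at all points near [x0]. *)
have [L L0 H] := Lip x0.
apply/continuous_distP => e e0.
pose m := Num.min 1 (e / (4 * L)).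
have m0 : 0 < m by rewrite lt_min ltr01 divr_gt0// mulr_gt0.
have : m / 2 < m by lra.
have h0 : 0 < m / 2 by rewrite divr_gt0.
set h := m / 2 in h0 *; rewrite /m lt_min => /andP[h1].
rewrite ltr_pdivlMr ?mulr_gt0// => hL.
have cdq := @continuous_diff_quotient i h g ((hu.1.2 k) j).2.
have e20 : 0 < e / 2 by rewrite divr_gt0.
have /continuous_distP/(_ _ e20)[r r0 Hr] := cdq x0.
exists (Num.min r 1) => [|x]; first by rewrite lt_min r0 ltr01.
rewrite lt_min => /andP[/Hr xr /ltW x1].
have hn0 : h != 0 by rewrite gt_eqF.
have hn : `|h| = h by rewrite ger0_norm// ltW.
have := (dq x L L0 (H x x1)).2 h hn0; rewrite hn => /(_ h1) A.
have x01 : `|x0 - x0| <= 1 by rewrite subrr normr0.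
have := (dq x0 L L0 (H x0 x01)).2 h hn0; rewrite hn => /(_ h1) B.
apply: (norm_sub_lt_approx A B xr).
by move: hL; clear; lra.
Qed.

Lemma C1_diff_quotient i h f : C1 f -> C1 (diff_quotient i h f).
Proof.
move=> Cf; have Cs := C1_axis_map (axis_map_shift (h *: 'e_i)) Cf.
exact: (C1_lin h^-1 (- h^-1) Cs Cf).
Qed.

Lemma diff_quotientC i j h f x :
  diff_quotient i h (diff_quotient j h f) x =
  diff_quotient j h (diff_quotient i h f) x.
Proof. by rewrite !diff_quotientE [x + _ + _]addrAC; ring. Qed.

Lemma diff_quotient2_MVT i j h f x : C2 f -> h != 0 ->
  exists2 y, `|y - x| <= 2 * `|h| &
    diff_quotient i h (diff_quotient j h f) x = partial j (partial i f) y.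
Proof.
move=> Cf h0; rewrite diff_quotientE.
have [s sh ->] := C1_MVT x i h (C1_diff_quotient j h Cf.1).
rewrite mulKf// (partial_diff_quotient j i h Cf.1) diff_quotientE.
have [t th ->] := C1_MVT (x + s *: 'e_i) j h (Cf.2 i).
rewrite mulKf//; exists (x + s *: 'e_i + t *: 'e_j) => //.
have -> : x + s *: 'e_i + t *: 'e_j - x = s *: 'e_i + t *: 'e_j.
  by apply/rowP => a; rewrite !mxE; ring.
have := rV_norm_scale_delta s i; have := rV_norm_scale_delta t j.
by have := ler_normD (s *: 'e_i : V) (t *: 'e_j); move: sh th; clear; lra.
Qed.

(** The symmetric second difference quotient is a value of each mixed partial at a point near [x];
    continuity of both concludes. *)
Lemma partialC f i j : C2 f -> partial i (partial j f) = partial j (partial i f).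
Proof.
move=> Cf; apply/funext => x.
apply/eqP; rewrite -subr_eq0 -normr_eq0 eq_le normr_ge0 andbT.
apply/ler_addgt0Pr => e e0; rewrite add0r.
have e20 : 0 < e / 2 by rewrite divr_gt0.
have /continuous_distP/(_ _ e20)[r r0 Hr] := ((Cf.2 j) i).2 x.
have /continuous_distP/(_ _ e20)[s s0 Hs] := ((Cf.2 i) j).2 x.
pose m := Num.min r s.
have m0 : 0 < m by rewrite lt_min r0.
have h0 : m / 4 != 0 by rewrite gt_eqF// divr_gt0.
have : 2 * `|m / 4| < m by rewrite ger0_norm ?divr_ge0 ?(ltW m0)//; lra.
rewrite {2}/m lt_min => /andP[hr hs].
have [y yx Ey] := diff_quotient2_MVT i j x Cf h0.
have [z zx Ez] := diff_quotient2_MVT j i x Cf h0.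
have Eyz : partial i (partial j f) z = partial j (partial i f) y.
  by rewrite -Ey -Ez diff_quotientC.
apply: (le_trans (ler_distD (partial i (partial j f) z) _ _)).
rewrite (splitr e); apply: lerD.
  by rewrite distrC; exact: ltW (Hr z (le_lt_trans zx hr)).
by rewrite Eyz; exact: ltW (Hs y (le_lt_trans yx hs)).
Qed.

Lemma harmonic_partial u i : harmonic u -> harmonic (partial i u).
Proof.
move=> hu; split; first by split; [exact: hu.1.2|move=> j; exact: harmonic_C3].
move=> x.
have E : laplacian u = \sum_j partial j (partial j u).
  by apply/funext => y; rewrite fct_sumE.
transitivity (partial i (laplacian u) x).
  rewrite E [RHS]derive_sum => [|j]; last first.
    exact: C1_deriv (harmonic_C3 j j hu).
  apply: eq_bigr => j _.
  (* The derivative along [i] is moved outwards past one [j], then past the other; the second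
     exchange uses the third derivatives of [u]. *)
  rewrite (partialC j i hu.1).
  have hj : C2 (partial j u) by split; [exact: hu.1.2|move=> k; exact: harmonic_C3].
  by rewrite (partialC j i hj).
have -> : laplacian u = cst 0 by apply/funext => y; exact: hu.2.
exact: derive_cst.
Qed.
End Regularity.

(** * Iterated Laplacians of sums of squares *)

(** Induction common to both settings: [L] sends a non-negative multiple of a sum of squares over
    [I] to one over [I * J], so the index type and the factor must vary in the induction. *)
Lemma iter_sum_sqr_ge0 (R : realType) (T : Type) (L : (T -> R) -> T -> R)
    (H : (T -> R) -> Prop) (J : finType) (D : J -> (T -> R) -> T -> R) (c : R) :
  0 <= c -> (forall j f, H f -> H (D j f)) ->
  (forall (I : finType) (a : R) (f : I -> T -> R), (forall i, H (f i)) ->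
     L (fun x => a * \sum_i f i x ^+ 2) =
     (fun x => c * a * \sum_i \sum_j D j (f i) x ^+ 2)) ->
  forall k (I : finType) (a : R) (f : I -> T -> R), 0 <= a ->
    (forall i, H (f i)) ->
    forall x, 0 <= iter k L (fun x => a * \sum_i f i x ^+ 2) x.
Proof.
move=> c0 HD HL; elim=> [|k IH] I a f a0 Hf x.
  by rewrite mulr_ge0// sumr_ge0// => i _; exact: sqr_ge0.
(* The innermost [L] is peeled off, leaving [k] iterations on the enlarged family. *)
rewrite iterSr HL//.
under [X in iter k L X]eq_fun do rewrite pair_bigA.
by apply: (IH _ _ (fun p : I * J => D p.2 (f p.1))) => [|p]; [exact: mulr_ge0|exact: HD].
Qed.

(** * Cayley graphs *)

Section Cayley.
Context {R : realType} {A : zmodType} (S : {fset A}).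
Implicit Types (u : A -> R).

(** Translation by [s] commutes with the Laplacian because [A] is Abelian. *)
Lemma cay_harmonic_diff u (s : A) :
  cay_harmonic S u -> cay_harmonic S (fun x => u (x + s) - u x).
Proof.
move=> hu x; rewrite -[RHS](subrr 0) -{1}(hu (x + s)) -(hu x).
rewrite /cay_laplacian -mulrBr -sumrB; congr (_ * _).
by apply: eq_bigr => t _; rewrite [x + s + t]addrAC; ring.
Qed.

(** From [q ^+ 2 - p ^+ 2 = (q - p) ^+ 2 + 2 * p * (q - p)]: summed over [S], the last term vanishes
    by harmonicity. *)
Lemma cay_laplacian_sum_sqr (I : finType) (a : R) (f : I -> A -> R) :
  (forall i, cay_harmonic S (f i)) ->
  cay_laplacian S (fun x => a * \sum_i f i x ^+ 2) =
  (fun x => (#|` S|%:R)^-1 * a *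
     \sum_i \sum_(s : S) (f i (x + val s) - f i x) ^+ 2).
Proof.
move=> hf; apply/funext => x.
transitivity (a * \sum_i cay_laplacian S (fun y => f i y ^+ 2) x).
  rewrite /cay_laplacian -mulr_sumr mulrCA; congr (_ * _).
  rewrite exchange_big [RHS]mulr_sumr; apply: eq_bigr => s _.
  by rewrite -mulrBr -sumrB.
rewrite [_^-1 * a]mulrC -mulrA; congr (_ * _).
rewrite mulr_sumr; apply: eq_bigr => i _.
rewrite -(big_seq_fsetE _ _ xpredT (fun s => (f i (x + s) - f i x) ^+ 2))/=.
(* The cross term is inserted as [2 * f i x] times the vanishing Laplacian, after which the sums
   agree termwise. *)
rewrite -[RHS]addr0 -[X in _ = _ + X](mulr0 (2 * f i x)).
rewrite -[X in _ = _ + _ * X](hf i x) /cay_laplacian.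
rewrite [X in _ + X]mulrCA -mulrDr; congr (_ * _).
rewrite mulr_sumr -big_split/=.
by apply: eq_bigr => s _; ring.
Qed.
End Cayley.

(** * Euclidean space *)

Section LaplacianSquares.
Context {R : realType} {d : nat}.
Local Notation V := 'rV[R]_d.

Lemma is_derive_sum_fun (I : finType) (h : I -> V -> R) (dh : I -> R) x v :
  (forall i, is_derive x v (h i) (dh i)) ->
  is_derive x v (fun y => \sum_i h i y) (\sum_i dh i).
Proof.
move=> Hh; have -> : (fun y => \sum_i h i y) = \sum_i h i.
  by apply/funext => y; rewrite fct_sumE.
by elim/big_ind2: _ => // [|*]; [exact: is_derive_cst|exact: is_deriveD].
Qed.

(** The Laplacian of [f ^+ 2] is twice the squared gradient plus [2 * f] times the Laplacian of [f],
    which is zero. *)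
Lemma laplacian_sum_sqr (I : finType) (a : R) (f : I -> V -> R) :
  (forall i, harmonic (f i)) ->
  laplacian (fun x => a * \sum_i f i x ^+ 2) =
  (fun x => 2 * a * \sum_i \sum_j partial j (f i) x ^+ 2).
Proof.
move=> hf.
have df i j y : is_derive y 'e_j (f i) (partial j (f i) y).
  exact: derivableP (C1_deriv j y (hf i).1.1).
have ddf i j y : is_derive y 'e_j (partial j (f i)) (partial j (partial j (f i)) y).
  exact: derivableP (C1_deriv j y ((hf i).1.2 j)).
have E1 j : partial j (fun x => a * \sum_i f i x ^+ 2) =
    (fun y => a * \sum_i f i y * (2 * partial j (f i) y)).
  apply/funext => y.
  have H i : is_derive y 'e_j (fun z => f i z ^+ 2) (f i y * (2 * partial j (f i) y)).
    apply: is_derive_eq (is_deriveM (df i j y) (df i j y)) _.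
    by rewrite /GRing.scale/=; ring.
  by have [] := is_deriveZ a (is_derive_sum_fun H).
have E2 j y : partial j (fun y => a * \sum_i f i y * (2 * partial j (f i) y)) y =
    a * \sum_i (f i y * (2 * partial j (partial j (f i)) y) +
                2 * partial j (f i) y ^+ 2).
  have H i : is_derive y 'e_j (fun z => f i z * (2 * partial j (f i) z))
      (f i y * (2 * partial j (partial j (f i)) y) + 2 * partial j (f i) y ^+ 2).
    apply: is_derive_eq (is_deriveM (df i j y) (is_deriveZ 2 (ddf i j y))) _.
    by rewrite /GRing.scale/= /GRing.scale/=; ring.
  by have [] := is_deriveZ a (is_derive_sum_fun H).
apply/funext => y.
rewrite /laplacian; under eq_bigr => j _ do rewrite E1 E2.
rewrite -mulr_sumr exchange_big/= [2 * a]mulrC -mulrA; congr (_ * _).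
rewrite mulr_sumr; apply: eq_bigr => i _.
rewrite big_split/= -!mulr_sumr [X in _ * (_ * X)](hf i).2.
by rewrite !mulr0 add0r.
Qed.
End LaplacianSquares.

Theorem theorem2p1 (R : realType) :
  (forall (A : zmodType) (S : {fset A}) (u : A -> R),
     generating S -> cay_harmonic S u ->
     forall (k : nat) (x : A),
       0 <= iter k (@cay_laplacian R A S) (fun y => u y ^+ 2) x)
  /\
  (forall (d : nat) (u : 'rV[R]_d -> R),
     harmonic u ->
     forall (k : nat) (x : 'rV[R]_d),
       0 <= iter k (@laplacian R d) (fun y => u y ^+ 2) x).
Proof.
(* The square of [u] is the starting family, with a single member and factor 1. *)
have sqE (T : Type) (u : T -> R) :
    (fun y => u y ^+ 2) = (fun y => 1 * \sum_(i < 1) u y ^+ 2).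
  by apply/funext => y; rewrite big_ord1 mul1r.
split=> [A S u _ hu k x|d u hu k x]; rewrite sqE.
  (* This covers empty [S] too, as the inverse of 0 is 0 by convention. *)
  have c0 : 0 <= (#|` S|%:R)^-1 :> R by rewrite invr_ge0.
  exact: (@iter_sum_sqr_ge0 R A _ (cay_harmonic S) S
    (fun s f x => f (x + val s) - f x) (#|` S|%:R)^-1 c0
    (fun s f => @cay_harmonic_diff R A S f (val s))
    (@cay_laplacian_sum_sqr R A S) k 'I_1 1 (fun=> u) ler01 (fun=> hu) x).
exact: (@iter_sum_sqr_ge0 R _ _ (@harmonic R d) 'I_d (@partial R d) 2
  (ler0n _ 2) (fun j f => @harmonic_partial R d f j)
  (@laplacian_sum_sqr R d) k 'I_1 1 (fun=> u) ler01 (fun=> hu) x).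
Qed.
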